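(* Let $m,n\in\mathbb{Z}^+$ be relatively prime, $\mathbb{H}_{m/n}=\{(z_1,z_2)\in\mathbb{C}^2:|z_1|^{m/n}<|z_2|<1\}$, and for $j\in\{0,1,\dots,m-1\}$ let $K_j$ be the sub-Bergman kernel defined below. Then for $(z,w)\in\mathbb{H}_{m/n}\times\mathbb{H}_{m/n}$, $$K_j(z,w)=\frac{n}{m\pi^2}\cdot\frac{f_j(s,t)\,g_j(t)\,s^j\,t^{\,n-1-E_j}}{(1-t)^2(t^n-s^m)^2},$$ where $s=z_1\bar w_1$, $t=z_2\bar w_2$, $E_j=\left\lfloor\frac{(j+1)n-1}{m}\right\rfloor$, and $$f_j(s,t)=(j+1)t^n+(m-j-1)s^m,\qquad g_j(t)=\left(j+1-\tfrac mnE_j\right)+\left(\tfrac mn+\tfrac mnE_j-j-1\right)t.$$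
   Context: Let $\mathcal{A}^2_{m/n}=\{(\alpha_1,\alpha_2)\in\mathbb{Z}^2:\alpha_1\ge0,\ n\alpha_1+m\alpha_2\ge -m-n+1\}$; these are exactly the $\alpha$ for which the monomial $z^\alpha=z_1^{\alpha_1}z_2^{\alpha_2}$ is holomorphic and square integrable (w.r.t. Lebesgue measure) on $\mathbb{H}_{m/n}$, and $\{z^\alpha\}_{\alpha\in\mathcal{A}^2_{m/n}}$ is an orthogonal basis of the Bergman space $A^2(\mathbb{H}_{m/n})$. For $j\in\{0,\dots,m-1\}$ let $\mathcal{G}_j=\{\alpha\in\mathcal{A}^2_{m/n}:\alpha_1\equiv j\pmod m\}$ and let $\mathcal{S}_j$ be the closed subspace of $A^2(\mathbb{H}_{m/n})$ spanned by $\{z^\alpha:\alpha\in\mathcal{G}_j\}$. The sub-Bergman kernel $K_j$ is the integral kernel of the orthogonal projection $L^2(\mathbb{H}_{m/n})\to\mathcal{S}_j$, namely $K_j(z,w)=\sum_{\alpha\in\mathcal{G}_j} z^\alpha\bar w^\alpha/\|z^\alpha\|^2_{L^2(\mathbb{H}_{m/n})}$. *)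

(* Defs.v *)
From HB Require Import structures.
From mathcomp Require Import all_boot all_order all_algebra.
From mathcomp Require Import all_classical all_reals all_analysis.
From mathcomp Require Import complex.
Set Implicit Arguments. Unset Strict Implicit. Unset Printing Implicit Defensive.
Import Order.TTheory GRing.Theory Num.Theory.
Local Open Scope ring_scope.
Local Open Scope classical_set_scope.

Section Defs.
Variable R : realType.

(* a complex number z = x + i y is represented by the real pair (x, y);
   C^2 is represented by (R*R)*(R*R), i.e. R^4 *)
Definition cplx (a : R * R) : R[i] := (a.1 +i* a.2)%C.

Definition cabs (a : R * R) : R := Normc.normc (cplx a).

Definition Hmn (m n : nat) : set ((R * R) * (R * R)) :=
  [set p | (cabs p.1) `^ (m%:R / n%:R) < cabs p.2 < 1].

Definition leb2 := ((@lebesgue_measure R) \x (@lebesgue_measure R))%E.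
Definition leb4 := (leb2 \x leb2)%E.

Definition monom (alpha : int * int) (z1 z2 : R[i]) : R[i] :=
  z1 ^ alpha.1 * z2 ^ alpha.2.

Definition monom_norm2 (m n : nat) (alpha : int * int) : \bar R :=
  (\int[leb4]_(p in Hmn m n)
     ((Normc.normc (monom alpha (cplx p.1) (cplx p.2))) ^+ 2)%:E)%E.

Definition A2 (m n : nat) (alpha : int * int) : bool :=
  (0 <= alpha.1) && (- (m%:Z) - n%:Z + 1 <= n%:Z * alpha.1 + m%:Z * alpha.2).

Definition Gj (m n j : nat) (alpha : int * int) : bool :=
  A2 m n alpha && (alpha.1 == j%:Z %[mod m%:Z])%Z.

Definition Kterm (m n : nat) (alpha : int * int) (z1 z2 w1 w2 : R[i]) : R[i] :=
  monom alpha z1 z2 * (monom alpha w1 w2)^* / ((fine (monom_norm2 m n alpha))%:C)%C.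

Definition Kj_partial (m n j : nat) (z1 z2 w1 w2 : R[i]) (N : nat) : R[i] :=
  \sum_(i < N) \sum_(k < (2 * N)%N)
     let alpha := (i%:Z, k%:Z - N%:Z) in
     if Gj m n j alpha then Kterm m n alpha z1 z2 w1 w2 else 0.

End Defs.

(* Main.v *)
(** The monomial norms reduce to radial integrals: the chords of a disc show that
    |z|^2 maps Lebesgue measure on C to pi times Lebesgue measure on [0, +oo[, so
    the squared norm of z^alpha is
    pi^2 m / ((alpha_1 + 1) (n (alpha_1 + 1) + m (alpha_2 + 1))).
    With alpha_1 = j + m k and alpha_2 = l - n k - E_j - 1, the index set G_j is
    parametrised by (k, l) in N^2, since n (j + 1) - m E_j lies in [1, m].  In these
    coordinates the kernel is the product of the arithmetico-geometric series
    sum (j + 1 + m k) x^k, with x = s^m / t^n, and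
    sum (n (j + 1) - m E_j + m l) t^l.  The square partial sums over alpha become
    sums over regions squeezed between two squares in (k, l), hence converge to the
    product by absolute convergence. *)
Require Import Defs.
From HB Require Import structures.
From mathcomp Require Import all_boot all_order all_algebra.
From mathcomp Require Import all_classical all_reals all_analysis.
From mathcomp Require Import measurable_realfun.
From mathcomp Require Import complex zify ring lra.
Import Order.TTheory GRing.Theory Num.Theory numFieldNormedType.Exports.
Local Open Scope ring_scope.
Local Open Scope classical_set_scope.

(** * Lebesgue measure of discs and radial integrals *)

(** [x + sin x cos x] is an antiderivative, and its second summand vanishes at both ends. This is
    what the substitution [x = r sin u] leaves of the area of a disc. *)
Lemma integral_cos2 (R : realType) :
  (\int[@lebesgue_measure R]_(x in `[(- (pi / 2))%R, (pi / 2)%R]) (2 * cos x ^+ 2)%:E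
   = (pi : R)%:E)%E.
Proof.
have pi0 := pi_gt0 R.
pose F (x : R) := x + sin x * cos x.
have dF (x : R) : is_derive x 1 F (2 * cos x ^+ 2).
  rewrite /F; apply: is_derive_eq; rewrite /GRing.scale/=.
  by have := cos2Dsin2 x; rewrite !expr2 => h; nra.
have cF : continuous F.
  by move=> x; apply/differentiable_continuous/derivable1_diffP; exact: ex_derive.
rewrite (@continuous_FTC2 _ _ F); first last.
- by move=> x _; rewrite derive1E; exact: derive_val.
- split.
  + by move=> x _; exact: ex_derive.
  + by apply: cvg_at_right_filter; exact: cF.
  + by apply: cvg_at_left_filter; exact: cF.
- apply: continuous_subspaceT => x.
  apply: cvgM; first exact: cvg_cst.
  by rewrite expr2; apply: cvgM; exact: continuous_cos.
- lra.
- by rewrite /F -EFinB cosN sinN cos_pihalf !mulr0 !addr0 opprK; congr EFin; lra.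
Qed.

(** Substituting [x = r sin u] turns the half-chord into [r cos u] and brings out a second factor
    [r cos u]. *)
Lemma integral_chord (R : realType) (r : R) : 0 < r ->
  (\int[@lebesgue_measure R]_(x in `[(- r)%R, r])
     (2 * Num.sqrt (r ^+ 2 - x ^+ 2))%:E = (pi * r ^+ 2)%:E)%E.
Proof.
move=> r0; have pi0 := pi_gt0 R.
pose F (x : R) := r * sin x.
have dF (x : R) : is_derive x 1 F (r * cos x).
  by rewrite /F; apply: is_derive_eq.
have F'E : F^`() = (fun x => r * cos x).
  by apply/funext => x; rewrite derive1E; exact: derive_val.
have cF : continuous F.
  by move=> x; apply/differentiable_continuous/derivable1_diffP; exact: ex_derive.
have cF' : continuous F^`().
  by rewrite F'E => x; apply: cvgM; [exact: cvg_cst|exact: continuous_cos].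
have FE : F (pi / 2) = r by rewrite /F sin_pihalf mulr1.
have FNE : F (- (pi / 2)) = - r by rewrite /F sinN sin_pihalf mulrN1.
(* Only the integration bounds become values of [F]; the radius inside the integrand stays [r]. *)
rewrite -{1}FNE -{1}FE integration_by_substitution_increasing; first last.
- apply: continuous_subspaceT => x.
  apply: cvgM; first exact: cvg_cst.
  apply: continuous_comp; last exact: sqrt_continuous.
  apply: cvgB; first exact: cvg_cst.
  exact: exprn_continuous.
- split.
  + by move=> x _; exact: ex_derive.
  + by apply: cvg_at_right_filter; exact: cF.
  + by apply: cvg_at_left_filter; exact: cF.
- by apply/cvg_ex; exists (F^`() (pi / 2)); apply: cvg_at_left_filter; exact: cF'.
- by apply/cvg_ex; exists (F^`() (- (pi / 2))); apply: cvg_at_right_filter; exact: cF'.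
- by move=> x _; exact: cF'.
- by move=> x y xp yp xy; rewrite ltr_pM2l// ltr_sin.
- lra.
transitivity (\int[@lebesgue_measure R]_(x in `[(- (pi / 2))%R, (pi / 2)%R])
   ((r ^+ 2)%:E * (2 * cos x ^+ 2)%:E))%E.
  apply: eq_integral => x; rewrite inE/= in_itv/= => xpi.
  rewrite -EFinM F'E /F fctE/= exprMn -[X in X - _]mulr1 -mulrBr -cos2sin2.
  rewrite -exprMn sqrtr_sqr ger0_norm; first by congr EFin; ring.
  by rewrite mulr_ge0 ?(ltW r0)// cos_ge0_pihalf.
rewrite ge0_integralZl ?integral_cos2 ?lee_fin ?sqr_ge0//.
- by rewrite -EFinM mulrC.
- apply/measurable_EFinP; apply: measurable_funM => //.
  apply: measurable_funX; apply: measurable_funTS; apply: continuous_measurable_fun.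
  exact: continuous_cos.
- by move=> x _; rewrite lee_fin mulr_ge0// sqr_ge0.
Qed.

(** The squared modulus is preferred to the modulus because it carries planar Lebesgue measure to a
    measure of constant density on the half-line, so that no Jacobian appears. *)
Definition sqnorm {R : realType} (p : R * R) : R := p.1 ^+ 2 + p.2 ^+ 2.

Lemma sqnorm_ge0 (R : realType) (p : R * R) : 0 <= sqnorm p.
Proof. by rewrite addr_ge0 ?sqr_ge0. Qed.

Lemma measurable_sqnorm (R : realType) :
  measurable_fun [set: measurableTypeR R * measurableTypeR R]
    (@sqnorm R : _ -> measurableTypeR R).
Proof.
apply: measurable_funD; apply: measurable_funX.
- exact: measurable_fst.
- exact: measurable_snd.
Qed.

Lemma measurable_sqnorm_fst (R : realType) :
  measurable_fun [set: (measurableTypeR R * measurableTypeR R) *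
                       (measurableTypeR R * measurableTypeR R)]
    (fun p => sqnorm p.1 : measurableTypeR R).
Proof. by apply: (measurableT_comp (measurable_sqnorm R)); exact: measurable_fst. Qed.

Lemma measurable_sqnorm_snd (R : realType) :
  measurable_fun [set: (measurableTypeR R * measurableTypeR R) *
                       (measurableTypeR R * measurableTypeR R)]
    (fun p => sqnorm p.2 : measurableTypeR R).
Proof. by apply: (measurableT_comp (measurable_sqnorm R)); exact: measurable_snd. Qed.

(** The product measure integrates the lengths of the sections: chords for abscissae in [[-r, r]],
    empty sets elsewhere. *)
Lemma leb2_disc (R : realType) (r : R) : 0 < r ->
  leb2 [set p : R * R | sqnorm p < r ^+ 2] = (pi * r ^+ 2)%:E.
Proof.
move=> r0; rewrite /leb2 /product_measure1.
rewrite -integral_chord// [RHS]integral_mkcond; apply: eq_integral => x _ /=.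
rewrite patchE; case: ifPn => [|].
  rewrite inE/= in_itv/= => /andP[x1 x2].
  pose s := Num.sqrt (r ^+ 2 - x ^+ 2).
  have xr : 0 <= r ^+ 2 - x ^+ 2 by nra.
  rewrite (_ : xsection _ _ = `](- s), s[%classic); last first.
    apply/seteqP; split => y; rewrite /xsection/= inE/= in_itv/= /sqnorm/= -ltr_norml.
      by move=> h; rewrite -ltr_sqr ?nnegrE ?sqrtr_ge0// real_normK ?num_real// sqr_sqrtr//; lra.
    by rewrite -ltr_sqr ?nnegrE ?sqrtr_ge0// real_normK ?num_real// sqr_sqrtr//; lra.
  rewrite lebesgue_measure_itv/= lte_fin.
  have s0 : 0 <= s by exact: sqrtr_ge0.
  case: ltP => h; first by rewrite -EFinB -/s; congr EFin; ring.
  (* The degenerate chord at the two extreme abscissae, where [s = 0]. *)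
  congr EFin; rewrite -/s; lra.
rewrite notin_setE/= in_itv/= => /negP h.
rewrite (_ : xsection _ _ = set0) ?measure0//.
apply/seteqP; split => y //; rewrite /xsection/= inE/= /sqnorm/= => h'.
case: h; rewrite -ler_norml -ler_sqr ?nnegrE// ?(ltW r0)// real_normK ?num_real//.
by have := sqr_ge0 y; lra.
Qed.

(** The maximum with 0 accounts for [u <= 0], where no point qualifies; all left rays are thus
    treated at once. *)
Lemma leb2_sqnorm_lt (R : realType) (u : R) :
  leb2 [set p : R * R | sqnorm p < u] = (pi * Num.max u 0)%:E.
Proof.
case: (ltP 0 u) => u0.
  have := @leb2_disc R (Num.sqrt u); rewrite sqrtr_gt0 => /(_ u0).
  by rewrite sqr_sqrtr ?(ltW u0).
rewrite (_ : [set _ | _] = set0).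
  by rewrite /leb2 measure0 mulr0.
by apply/seteqP; split => p //=; have := sqnorm_ge0 _ p; lra.
Qed.

(** Both sides are measures that agree on the open left rays. These are stable under intersection,
    generate the Borel sets, and exhaust the line with finite measure, so uniqueness of measures
    applies. *)
Lemma pushforward_sqnorm (R : realType) (A : set (measurableTypeR R)) :
  measurable A ->
  pushforward (@leb2 R) (@sqnorm R : _ -> measurableTypeR R) A =
  (pi%:E * (@lebesgue_measure R) (A `&` `[0%R, +oo[))%E.
Proof.
move=> mA.
pose p0 : {nonneg R} := NngNum (pi_ge0 R).
pose push : {measure set (measurableTypeR R) -> \bar R} :=
  @pushforward _ _ _ _ _ ((@lebesgue_measure R) \x (@lebesgue_measure R))%E
    (@sqnorm R : measurableTypeR R * measurableTypeR R -> measurableTypeR R).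
pose m1 := push (measurable_sqnorm R).
pose m2 : {measure set (measurableTypeR R) -> \bar R} :=
  mscale p0 (mrestr (@lebesgue_measure R) (measurable_itv `[0%R, +oo[%O)).
have m1E x : m1 `]-oo, x[%classic = (pi * Num.max x 0)%:E.
  rewrite -leb2_sqnorm_lt /m1/= /pushforward.
  by rewrite (_ : sqnorm @^-1` _ = [set p | sqnorm p < x]).
apply: (@measure_unique _ R (measurableTypeR R) (@RGenInftyO.G R)
  (fun n => `]-oo, n%:R[%classic) (RGenInftyO.measurableE R) _ _ _ m1 m2 _ _ A mA).
- move=> _ _ [x ->] [y ->]; exists (Num.min x y).
  by apply/seteqP; split => z /=; rewrite !in_itv/= lt_min => /andP.
- by move=> n; exists n%:R.
- apply/seteqP; split => // x _; exists (Num.truncn `|x|).+1 => //=.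
  rewrite in_itv/= (le_lt_trans (ler_norm _))//.
  by rewrite truncnS_gt.
- move=> _ [x ->]; rewrite m1E /m2/= /mscale /mrestr/= EFinM; congr (_ * _)%E; rewrite /mrestr.
  case: (ltP 0 x) => x0.
    rewrite (_ : _ `&` _ = `[0, x[%classic).
      by rewrite lebesgue_measure_itv/= lte_fin x0 oppr0 adde0.
    apply/seteqP; split => z /=; rewrite !in_itv/= andbT.
      by move=> [-> ->].
    by move=> /andP[-> ->].
  rewrite (_ : _ `&` _ = set0) ?measure0//.
  apply/seteqP; split => z //=; rewrite !in_itv/= andbT => -[]; lra.
- by move=> n; rewrite m1E ltry.
Qed.

(** Change of variables for the image measure. As [D] lies in the half-line, the restriction in that
    measure is invisible on [D]. *)
Lemma integral_sqnorm (R : realType) (D : set (measurableTypeR R))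
    (f : measurableTypeR R -> \bar R) :
  measurable D -> D `<=` `[0%R, +oo[ -> measurable_fun D f ->
  (forall u, D u -> 0 <= f u)%E ->
  (\int[@leb2 R]_(p in (@sqnorm R : _ -> measurableTypeR R) @^-1` D) f (sqnorm p)
   = pi%:E * \int[@lebesgue_measure R]_(u in D) f u)%E.
Proof.
move=> mD D0 mf f0.
have := @ge0_integral_pushforward _ _ _ _ _ _ (measurable_sqnorm R)
  ((@lebesgue_measure R) \x (@lebesgue_measure R))%E D f mD mf.
rewrite /leb2 => <-; last by move=> u /[!inE]; exact: f0.
pose p0 : {nonneg R} := NngNum (pi_ge0 R).
pose push : {measure set (measurableTypeR R) -> \bar R} :=
  @pushforward _ _ _ _ _ ((@lebesgue_measure R) \x (@lebesgue_measure R))%E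
    (@sqnorm R : measurableTypeR R * measurableTypeR R -> measurableTypeR R).
rewrite -(ge0_integral_mscale _ mD p0 mf f0).
apply: (@eq_measure_integral _ _ _ D _ (push (measurable_sqnorm R))).
move=> A mA AD; rewrite [LHS](pushforward_sqnorm _ _ mA) /mscale/=.
by congr (_ * lebesgue_measure _)%E; apply/setIidPl/(subset_trans AD).
Qed.

(** For [p < 1] the integrand is unbounded near 0, so the fundamental theorem of calculus is applied
    away from 0 and followed by a limit. *)
Lemma integral_powR (R : realType) (p r : R) : 0 < p -> 0 < r ->
  (\int[@lebesgue_measure R]_(u in `]0%R, r]) (u `^ (p - 1))%:E
   = (r `^ p / p)%:E)%E.
Proof.
move=> p0 r0.
(* The shift by 2 keeps [a n < r] strict already at [n = 0]. *)
pose a (n : nat) : R := r / n.+2%:R.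
have a0 n : 0 < a n by rewrite divr_gt0.
have ar n : a n < r by rewrite ltr_pdivrMr// ltr_pMr// ltr1n.
have cvga : a @ \oo --> (0 : R).
  rewrite -(mulr0 r); apply: cvgM; first exact: cvg_cst.
  by have := @cvg_harmonic R; rewrite -cvg_shiftS.
pose F (n : nat) : set (measurableTypeR R) := `[a n, r].
have UF : \bigcup_n F n = `]0%R, r]%classic.
  apply/seteqP; split => u /=; rewrite /F/= in_itv/=.
    by move=> [n _ /=]; rewrite in_itv/= => /andP[nu ->]; rewrite (lt_le_trans (a0 n)).
  move=> /andP[u0 ur].
  have /cvgrPdist_lt/(_ _ u0)[N _ /(_ N (leqnn N))] := cvga.
  rewrite sub0r normrN gtr0_norm// => aNu.
  by exists N => //=; rewrite in_itv/= ur (ltW aNu).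
have mpow (q : R) : measurable_fun [set: measurableTypeR R] (fun u => (u `^ q)%:E).
  by apply/measurable_EFinP; exact: measurable_powR.
have dF (u : R) : 0 < u -> is_derive u 1 (fun v => v `^ p / p) (u `^ (p - 1)).
  move=> u0.
  have uoo : u \in `]0, +oo[%R by rewrite in_itv/= u0.
  have dpow : is_derive u 1 (@powR R ^~ p) (p * u `^ (p - 1)).
    apply: DeriveDef; first exact: derivable_powR.
    by rewrite -derive1E powR_derive1.
  apply: is_derive_eq.
  by rewrite /GRing.scale/= mulr0 add0r mulrA mulVf ?gt_eqF// mul1r.
have cpow (q u : R) : 0 < u -> {for u, continuous (@powR R ^~ q)}.
  move=> u0; apply/differentiable_continuous/derivable1_diffP.
  by apply: derivable_powR; rewrite in_itv/= u0.
have FTC n : (\int[@lebesgue_measure R]_(u in F n) (u `^ (p - 1))%:E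
    = (r `^ p / p - a n `^ p / p)%:E)%E.
  rewrite (@continuous_FTC2 _ _ (fun u => u `^ p / p)) ?EFinB//.
  - apply/continuous_in_subspaceT => u; rewrite inE/= in_itv/= => /andP[au _].
    by apply: cpow; exact: lt_le_trans au.
  - split.
    + move=> u; rewrite in_itv/= => /andP[au _].
      by have ? := dF u (lt_trans (a0 n) au); exact: ex_derive.
    + apply: cvg_at_right_filter; apply: cvgM; last exact: cvg_cst.
      exact: cpow.
    + apply: cvg_at_left_filter; apply: cvgM; last exact: cvg_cst.
      exact: cpow.
  - move=> u; rewrite in_itv/= => /andP[au _].
    have ? := dF u (lt_trans (a0 n) au).
    by rewrite derive1E; exact: derive_val.
(* The same sequence of integrals has two limits: this one by monotone convergence, the next one
   from the explicit values, as [a n] to the power [p] vanishes. *)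
have h1 : (\int[@lebesgue_measure R]_(u in F n) (u `^ (p - 1))%:E)%E @[n --> \oo]
    --> (\int[@lebesgue_measure R]_(u in `]0%R, r]) (u `^ (p - 1))%:E)%E.
  rewrite -UF; apply: ge0_nondecreasing_set_cvg_integral.
  - move=> m n mn; rewrite subsetEset => u /=; rewrite /F/= !in_itv/= => /andP[mu ->].
    rewrite andbT (le_trans _ mu)// ler_pM2l// lef_pV2 ?posrE//.
    by rewrite ler_nat ltnS.
  - by move=> n; exact: measurable_itv.
  - by move=> n; apply: measurable_funTS.
  - by move=> n u _; rewrite lee_fin powR_ge0.
have h2 : (\int[@lebesgue_measure R]_(u in F n) (u `^ (p - 1))%:E)%E @[n --> \oo]
    --> (r `^ p / p)%:E.
  under eq_fun do rewrite FTC.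
  apply: cvg_EFin; first by near=> n.
  rewrite -[X in _ --> X]subr0 -[X in _ - X](mul0r p^-1).
  apply: cvgB; first exact: cvg_cst.
  apply: cvgM; last exact: cvg_cst.
  have /cvg_at_rightP := @powR_cvg0 R _ p0; apply; split => //.
exact: (cvg_unique _ h1 h2).
Unshelve. all: by end_near. Qed.

(** * Norms of the monomials *)

(** The flag [b] decides whether the centre of the disc is included: the fibre in [z_1] is a full
    disc, whereas [z_2] ranges over a punctured one. The endpoints are null sets. *)
Lemma integral_sqnorm_powR (R : realType) (b : bool) (q r : R) :
  -1 < q -> 0 < r ->
  (\int[@leb2 R]_(p in (@sqnorm R : _ -> measurableTypeR R) @^-1`
       [set` Interval (BSide b 0%R) (BLeft r)]) (sqnorm p `^ q)%:E
   = (pi * (r `^ (q + 1) / (q + 1)))%:E)%E.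
Proof.
move=> q1 r0.
rewrite (@integral_sqnorm _ _ (fun u => (u `^ q)%:E)).
- rewrite EFinM; congr (_ * _)%E.
  rewrite -integral_powR//; last lra.
  have mpow (D : set R) : measurable_fun D (fun u : R => (u `^ q)%:E).
    by apply/measurable_EFinP/measurable_funTS; exact: measurable_powR.
  rewrite integral_itv_bndoo// addrK.
  by rewrite -(@integral_itv_bndoo _ 0 r _ false false).
- exact: measurable_itv.
- by move=> u /=; rewrite !in_itv/= andbT => /andP[] /lteifW.
- by apply/measurable_EFinP/measurable_funTS; exact: measurable_powR.
- by move=> u _; rewrite lee_fin powR_ge0.
Qed.

Lemma normcX (R : realType) (x : R[i]) (k : nat) :
  Normc.normc (x ^+ k) = Normc.normc x ^+ k.
Proof. by elim: k => [|k IH]; rewrite ?expr0 ?Normc.normc1// !exprS Normc.normcM IH. Qed.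

Lemma normcXz (R : realType) (x : R[i]) (k : int) :
  Normc.normc (x ^ k) = Normc.normc x ^ k.
Proof. by case: k => k; rewrite ?NegzE -?invr_expz ?Normc.normcV normcX. Qed.

Lemma sqr_cabs (R : realType) (p : R * R) : cabs p ^+ 2 = sqnorm p.
Proof. by rewrite /cabs/= sqr_sqrtr// sqnorm_ge0. Qed.

Lemma cabs_ge0 (R : realType) (p : R * R) : 0 <= cabs p.
Proof. exact: sqrtr_ge0. Qed.

Lemma ltr_powR2 (R : realType) (r x y : R) : 0 < r -> 0 <= x -> 0 <= y ->
  (x `^ r < y `^ r) = (x < y).
Proof.
move=> r0 x0 y0; apply/idP/idP; last by apply: gt0_ltr_powR.
by apply: contraTT; rewrite -!leNgt; apply: ge0_ler_powR => //; exact: ltW.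
Qed.

(** Raising the defining inequality to the power [2 n / m] isolates the squared modulus of [z_1]:
    the fibre over [z_2] is a disc. That [z_2] is nonzero follows from the strict inequality and is
    made explicit. *)
Lemma HmnE (R : realType) (m n : nat) : (0 < m)%N -> (0 < n)%N ->
  @Hmn R m n = [set p | (0 < sqnorm p.2 < 1) &&
                        (sqnorm p.1 < sqnorm p.2 `^ (n%:R / m%:R))].
Proof.
move=> m0 n0.
have mR : 0 < m%:R :> R by rewrite ltr0n.
have nR : 0 < n%:R :> R by rewrite ltr0n.
suff E (p : (R * R) * (R * R)) : (cabs p.1 `^ (m%:R / n%:R) < cabs p.2 < 1) =
    (0 < sqnorm p.2 < 1) && (sqnorm p.1 < sqnorm p.2 `^ (n%:R / m%:R)).
  by apply/funext => p; rewrite /Hmn /mkset E.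
rewrite -!sqr_cabs; move: (cabs_ge0 _ p.1) (cabs_ge0 _ p.2).
move: (cabs p.1) (cabs p.2) => a b a0 b0.
have -> : (a ^+ 2 < (b ^+ 2) `^ (n%:R / m%:R)) = (a `^ (m%:R / n%:R) < b).
  rewrite -(@ltr_powR2 _ (m%:R / n%:R)) ?divr_gt0 ?sqr_ge0 ?powR_ge0//.
  rewrite -powRrM mulrA divfK ?gt_eqF// mulfV ?gt_eqF// powRr1 ?sqr_ge0//.
  rewrite -!powR_mulrn// powRAC ltr_powR2 ?powR_ge0//.
have [ab|] := ltP (a `^ (m%:R / n%:R)) b; last by rewrite andbF.
have b1 : 0 < b by rewrite (le_lt_trans _ ab)// powR_ge0.
by rewrite andbT expr_lt1// exprn_gt0.
Qed.

(** * Measurability of the domain and Tonelli's theorem on C^2 *)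

Lemma measurable_Hmn (R : realType) (m n : nat) : (0 < m)%N -> (0 < n)%N ->
  measurable (@Hmn R m n : set ((measurableTypeR R * measurableTypeR R) *
                                (measurableTypeR R * measurableTypeR R))).
Proof.
move=> m0 n0; rewrite HmnE//.
set T := (measurableTypeR R * measurableTypeR R)%type.
have ms1 := measurable_sqnorm_fst R; have ms2 := measurable_sqnorm_snd R.
have mb : measurable_fun [set: T * T] (fun p : T * T => (0 < sqnorm p.2 < 1) &&
    (sqnorm p.1 < sqnorm p.2 `^ (n%:R / m%:R))).
  apply: measurable_and; first by apply: measurable_and; exact: measurable_fun_ltr.
  apply: measurable_fun_ltr => //.
  exact: (measurableT_comp (measurable_powR _)).
by rewrite -preimage_true -[X in measurable X]setTI; exact: mb.
Qed.

Lemma sigma_finite_leb2 (R : realType) : sigma_finite setT (@leb2 R).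
Proof.
exists (fun n : nat => [set p : R * R | sqnorm p < n%:R]).
  apply/seteqP; split => // p _; exists (Num.truncn (sqnorm p)).+1 => //=.
  exact: truncnS_gt.
move=> n; split; last by rewrite leb2_sqnorm_lt ltry.
have := measurable_sqnorm R; move=> /(_ measurableT `]-oo, n%:R[%classic (measurable_itv _)).
rewrite setTI; congr measurable.
Qed.

(** The variable [z_2] is outermost because the fibres over it are discs. *)
Lemma fubini_leb4 (R : realType)
    (D : set ((measurableTypeR R * measurableTypeR R) *
              (measurableTypeR R * measurableTypeR R)))
    (f : (measurableTypeR R * measurableTypeR R) *
         (measurableTypeR R * measurableTypeR R) -> \bar R) :
  measurable D -> measurable_fun D f -> (forall p, 0 <= f p)%E ->
  (\int[@leb4 R]_(p in D) f p =
   \int[@leb2 R]_y \int[@leb2 R]_x (f \_ D) (x, y))%E.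
Proof.
move=> mD mf f0.
(* The exhaustion by discs equips the planar measure with the sigma-finite structure that Tonelli's
   theorem requires. *)
pose mu0 : {measure set (measurableTypeR R * measurableTypeR R)%type -> \bar R} :=
  ((@lebesgue_measure R) \x (@lebesgue_measure R))%E.
pose mix := @Measure_isSigmaFinite.Build _ _ _ mu0 (sigma_finite_leb2 R).
pose mu2 : {sigma_finite_measure set (measurableTypeR R * measurableTypeR R)%type -> \bar R} :=
  HB.pack (Measure.sort mu0) mix.
transitivity (\int[mu2 \x mu2]_p (f \_ D) p)%E.
  by rewrite -integral_mkcond.
apply: (@fubini_tonelli2 _ _ _ _ _ mu2 mu2).
  exact: (measurable_restrictT f mD).1 mf.
by move=> p; apply: erestrict_ge0.
Qed.

(** The second exponent may be negative, hence the real power on that factor. *)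
Lemma normc_monom (R : realType) (k : nat) (l : int) (a b : R * R) :
  Normc.normc (monom (k%:Z, l) (cplx a) (cplx b)) ^+ 2 =
  sqnorm a ^+ k * sqnorm b `^ l%:~R.
Proof.
rewrite /monom Normc.normcM !normcXz exprMn -/(cabs a) -/(cabs b).
rewrite powR_intmul ?sqnorm_ge0// -!sqr_cabs; congr (_ * _).
  by rewrite -!exprnP -!exprM mulnC.
by rewrite !exprnP !exprz_exp mulrC.
Qed.

(** Integrating [z_1] over its fibre contributes [pi / (k + 1)] and raises the exponent of the
    squared modulus of [z_2] from [l] to [q]; a radial integral over the punctured unit disc
    remains. *)
Lemma monom_norm2E (R : realType) (m n k : nat) (l : int) :
  (0 < m)%N -> (0 < n)%N -> - (m%:Z) - n%:Z + 1 <= n%:Z * k%:Z + m%:Z * l ->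
  @monom_norm2 R m n (k%:Z, l) =
  (pi ^+ 2 * m%:R / (k.+1%:R * (n%:R * k.+1%:R + m%:R * (l%:~R + 1))))%:E.
Proof.
move=> m0 n0 kl.
have mR : 0 < m%:R :> R by rewrite ltr0n.
have nR : 0 < n%:R :> R by rewrite ltr0n.
pose q : R := l%:~R + n%:R / m%:R * k.+1%:R.
pose A : R := n%:R * k.+1%:R + m%:R * (l%:~R + 1).
(* The hypothesis on the exponents says [A >= 1]; as [A = m (q + 1)], this gives the integrability
   condition [q > -1]. *)
have A0 : 0 < A.
  move: kl; rewrite -(ler_int R) !rmorphD !rmorphN !rmorphM/= => kl.
  by rewrite /A -natr1; lra.
have qE : q + 1 = A / m%:R by rewrite /q /A; field; rewrite gt_eqF.
have q1 : -1 < q by rewrite -subr_gt0 opprK qE divr_gt0.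
pose T := (measurableTypeR R * measurableTypeR R)%type.
pose f (p : T * T) : \bar R := (sqnorm p.1 ^+ k * sqnorm p.2 `^ l%:~R)%:E.
have mf : measurable_fun [set: T * T] f.
  have ms1 := measurable_sqnorm_fst R; have ms2 := measurable_sqnorm_snd R.
  apply/measurable_EFinP; apply: measurable_funM; first exact: measurable_funX.
  exact: (measurableT_comp (measurable_powR _)).
have f0 p : (0 <= f p)%E.
  by rewrite lee_fin mulr_ge0 ?exprn_ge0 ?sqnorm_ge0 ?powR_ge0.
have -> : @monom_norm2 R m n (k%:Z, l) =
    (\int[@leb4 R]_(p in (Hmn m n : set (T * T))) f p)%E.
  rewrite /monom_norm2; congr integral; apply/funext => p.
  by rewrite /f normc_monom.
rewrite fubini_leb4//; last 2 first.
- exact: measurable_Hmn.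
- exact: measurable_funTS.
have mpow (r : R) (D : set T) : measurable_fun D (fun x : T => (sqnorm x `^ r)%:E).
  apply/measurable_EFinP/measurable_funTS.
  exact: (measurableT_comp (measurable_powR _) (measurable_sqnorm R)).
have mpre (I : interval R) :
    measurable ((@sqnorm R : T -> measurableTypeR R) @^-1` [set` I]).
  by rewrite -[X in measurable X]setTI; apply: measurable_sqnorm.
pose C : R := pi * (k.+1%:R)^-1.
transitivity (\int[((@lebesgue_measure R) \x (@lebesgue_measure R))]_(y in
    (@sqnorm R : T -> measurableTypeR R) @^-1`
      [set` Interval (BSide false 0%R) (BLeft (1%R : R))])
      (C%:E * (sqnorm y `^ q)%:E))%E.
  rewrite [RHS]integral_mkcond /leb2; apply: eq_integral => y _.
  rewrite patchE; case: ifPn; rewrite ?inE ?notin_setE/= in_itv/= => y01.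
    have [y0 y1] := andP y01.
    have r0 : 0 < sqnorm y `^ (n%:R / m%:R) by exact: powR_gt0.
    transitivity (\int[((@lebesgue_measure R) \x (@lebesgue_measure R))]_(x in
      (@sqnorm R : T -> measurableTypeR R) @^-1`
      [set` Interval (BSide true 0%R) (BLeft (sqnorm y `^ (n%:R / m%:R))%R)])
        ((sqnorm y `^ l%:~R)%:E * (sqnorm x `^ k%:R)%:E))%E.
      rewrite [RHS]integral_mkcond /leb2; apply: eq_integral => x _.
      rewrite !patchE.
      have -> : ((x, y) \in (@Hmn R m n)) = (sqnorm x < sqnorm y `^ (n%:R / m%:R)).
        by rewrite HmnE//; apply/idP/idP; rewrite inE/= y01.
      have -> : (x \in (@sqnorm R : T -> measurableTypeR R) @^-1`
          [set` Interval (BSide true 0%R) (BLeft (sqnorm y `^ (n%:R / m%:R)))]) =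
          (sqnorm x < sqnorm y `^ (n%:R / m%:R)).
        by apply/idP/idP; rewrite inE/= in_itv/= sqnorm_ge0.
      case: ifPn => // _.
      by rewrite -EFinM /f/= powR_mulrn ?sqnorm_ge0// mulrC.
    rewrite ge0_integralZl//.
    + rewrite [X in (_ * X)%E]integral_sqnorm_powR//; last first.
        by rewrite (lt_le_trans _ (ler0n _ _))// ltrN10.
      rewrite -!EFinM; congr EFin.
      (* Exponents may be added because [y] is nonzero on the punctured disc. *)
      rewrite natr1 -powRrM /q powRD; last by rewrite [sqnorm y == 0]gt_eqF// implybT.
      by rewrite /C; ring.
    + by move=> x _; rewrite lee_fin powR_ge0.
    + by rewrite lee_fin powR_ge0.
  (* Off the punctured unit disc the fibre is empty. *)
  apply: integral0_eq => x _; rewrite patchE HmnE// ifF//.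
  by apply/negP; rewrite inE/= => /andP[].
rewrite ge0_integralZl//.
- rewrite [X in (_ * X)%E]integral_sqnorm_powR// powR1 -EFinM qE /C /A; congr EFin.
  have alg (a b c d : R) : 0 < a -> 0 < b -> 0 < c ->
      d / a * (d * (1 / (b / c))) = d ^+ 2 * c / (a * b).
    by move=> ? ? ?; field; rewrite !gt_eqF.
  by apply: alg; rewrite ?ltr0n.
- by move=> x _; rewrite lee_fin powR_ge0.
- by rewrite lee_fin /C mulr_ge0 ?invr_ge0 ?pi_ge0.
Qed.

(** * Double arithmetico-geometric series *)

(** Clearing the denominator leaves a polynomial identity, proved by induction in any commutative
    ring. It separates the limit from a remainder carrying the factor [x ^+ M]. *)
Lemma arith_geom_sum (K : comNzRingType) (c d x : K) (M : nat) :
  (1 - x) ^+ 2 * (\sum_(k < M) (c + d * k%:R) * x ^+ k) =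
  (c + (d - c) * x) - x ^+ M * ((c + d * M%:R) * (1 - x) + d * x).
Proof.
elim: M => [|M IH]; first by rewrite big_ord0 expr0; ring.
by rewrite big_ord_recr/= mulrDr IH [x ^+ M.+1]exprS -natr1; ring.
Qed.

Lemma cvg_exprM (R : realType) (r : R) : 0 <= r < 1 ->
  (fun M => r ^+ M * M%:R) @ \oo --> (0 : R).
Proof.
move=> /andP[r0 r1].
(* Bernoulli: [M p^M (1 - p) <= 1], so [M r^M] is at most [p^M / (1 - p)]. *)
pose p := Num.sqrt r.
have p0 : 0 <= p by exact: sqrtr_ge0.
have p1 : p < 1 by rewrite -(@ltr_pXn2r _ 2) ?nnegrE// sqr_sqrtr ?expr1n.
have rE : r = p * p by rewrite -expr2 sqr_sqrtr.
have bnd M : p ^+ M * M%:R * (1 - p) <= 1 - p ^+ M.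
  elim: M => [|M IH]; first by rewrite expr0; lra.
  rewrite exprS -natr1.
  have pM0 : 0 <= p ^+ M by exact: exprn_ge0.
  have pM1 : p ^+ M <= 1 by apply: exprn_ile1 => //; exact: ltW.
  have : p * (p ^+ M * M%:R * (1 - p)) <= p * (1 - p ^+ M) by rewrite ler_wpM2l.
  have : p * p ^+ M * (1 - p) <= 1 - p.
    apply: ler_piMl; first by rewrite subr_ge0 ltW.
    by apply: mulr_ile1 => //; exact: ltW.
  set a := p ^+ M; set b := M%:R.
  lra.
have cvgp : (fun M => p ^+ M / (1 - p)) @ \oo --> (0 : R).
  rewrite -(mul0r (1 - p)^-1); apply: cvgM; last exact: cvg_cst.
  by apply: cvg_expr; rewrite ger0_norm.
apply: (squeeze_cvgr _ (cvg_cst 0) cvgp).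
near=> M; rewrite mulr_ge0 ?exprn_ge0//= rE exprMn -mulrA.
rewrite ler_wpM2l ?exprn_ge0// -[(1 - p)^-1]mul1r ler_pdivlMr ?subr_gt0//.
rewrite (le_trans (bnd M))// lerBlDr lerDl exprn_ge0//.
Unshelve. all: by end_near. Qed.

(** The real version serves the series of moduli, whose convergence is the absolute convergence
    needed for the double series. *)
Lemma cvg_arith_geom (R : realType) (c d r : R) : 0 <= r < 1 ->
  (fun M => \sum_(k < M) (c + d * k%:R) * r ^+ k) @ \oo -->
  (c + (d - c) * r) / (1 - r) ^+ 2.
Proof.
move=> r01; have /andP[r0 r1] := r01.
have r1' : (1 - r) ^+ 2 != 0 by rewrite expf_neq0// subr_eq0 gt_eqF.
(* The remainder is split into a multiple of [r ^+ M] and a multiple of [M r ^+ M], both of which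
   vanish. *)
have -> : (fun M => \sum_(k < M) (c + d * k%:R) * r ^+ k) =
  (fun M => (c + (d - c) * r - (r ^+ M * (c * (1 - r) + d * r) +
             r ^+ M * M%:R * (d * (1 - r)))) / (1 - r) ^+ 2).
  apply/funext => M; apply: (mulfI r1'); rewrite arith_geom_sum.
  by rewrite mulrCA mulfV// mulr1; ring.
have -> : (c + (d - c) * r) / (1 - r) ^+ 2 =
    (c + (d - c) * r - (0 * (c * (1 - r) + d * r) + 0 * (d * (1 - r)))) / (1 - r) ^+ 2.
  by rewrite !mul0r addr0 subr0.
apply: cvgM; last exact: cvg_cst.
apply: cvgB; first exact: cvg_cst.
apply: cvgD; apply: cvgM; try exact: cvg_cst.
  by apply: cvg_expr; rewrite ger0_norm.
exact: cvg_exprM.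
Qed.

Lemma normcD (R : realType) (x y : R[i]) :
  Normc.normc (x + y) <= Normc.normc x + Normc.normc y.
Proof. exact: le_normcD. Qed.

Lemma normc_ge0 (R : realType) (x : R[i]) : 0 <= Normc.normc x.
Proof. by case: x => a b; exact: sqrtr_ge0. Qed.

Lemma normc_nat (R : realType) (n : nat) : Normc.normc (n%:R : R[i]) = n%:R.
Proof.
rewrite -(rmorph_nat (real_complex R))/= expr0n addr0 sqrtr_sqr ger0_norm//.
Qed.

Lemma normcNC (R : realType) (x : R[i]) : Normc.normc (- x) = Normc.normc x.
Proof. exact: normcN. Qed.

(** Complex convergence is expressed by a real modulus tending to 0; the remainder is bounded by the
    same two null sequences as in the real case. *)
Lemma cvg_arith_geomC (R : realType) (c d x : R[i]) : Normc.normc x < 1 ->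
  (fun M => Normc.normc (\sum_(k < M) (c + d * k%:R) * x ^+ k -
     (c + (d - c) * x) / (1 - x) ^+ 2)) @ \oo --> (0 : R).
Proof.
move=> x1; set r := Normc.normc x.
have r01 : 0 <= r < 1 by rewrite normc_ge0.
have x1' : 1 - x != 0.
  by apply/eqP => /subr0_eq h; move: x1; rewrite -h Normc.normc1 ltxx.
have x2' : (1 - x) ^+ 2 != 0 by rewrite expf_neq0.
pose C := Normc.normc (c * (1 - x) + d * x).
pose C' := Normc.normc (d * (1 - x)).
have : (fun M => (r ^+ M * C + r ^+ M * M%:R * C') / Normc.normc (1 - x) ^+ 2) @ \oo
    --> (0 : R).
  have -> : 0 = (0 * C + 0 * C') / Normc.normc (1 - x) ^+ 2.
    by rewrite !mul0r addr0 mul0r.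
  apply: cvgM; last exact: cvg_cst.
  apply: cvgD; apply: cvgM; try exact: cvg_cst; last exact: cvg_exprM.
  by apply: cvg_expr; rewrite ger0_norm//; case/andP: r01.
apply: squeeze_cvgr (cvg_cst 0).
near=> M; rewrite normc_ge0/=.
have -> : \sum_(k < M) (c + d * k%:R) * x ^+ k - (c + (d - c) * x) / (1 - x) ^+ 2 =
   - ((x ^+ M * (c * (1 - x) + d * x) + x ^+ M * M%:R * (d * (1 - x))) / (1 - x) ^+ 2).
  apply: (mulfI x2'); rewrite mulrBr arith_geom_sum mulrN !(mulrCA ((1 - x) ^+ 2)) mulfV//.
  by rewrite !mulr1; ring.
rewrite normcNC Normc.normcM Normc.normcV -normcX ler_wpM2r ?invr_ge0 ?normc_ge0//.
by rewrite (le_trans (normcD _ _ _))// /C /C' !Normc.normcM normcX normc_nat.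
Unshelve. all: by end_near. Qed.

(** * Double sums over regions squeezed between two squares *)

Lemma normc_sum (R : realType) (M : nat) (F : 'I_M -> R[i]) :
  Normc.normc (\sum_(i < M) F i) <= \sum_(i < M) Normc.normc (F i).
Proof.
elim/big_ind2 : _ => [|x a y b xa yb|//]; first by rewrite Normc.normc0.
by rewrite (le_trans (normcD _ _ _))// lerD.
Qed.

(** Padding with zeros up to a common bound lets sums over different regions be subtracted term by
    term. *)
Lemma prod_sum_box (V : comNzRingType) (M M' : nat) (A B : nat -> V) : (M <= M')%N ->
  (\sum_(k < M) A k) * (\sum_(l < M) B l) =
  \sum_(k < M') \sum_(l < M') if (k < M)%N && (l < M)%N then A k * B l else 0.
Proof.
move=> MM; rewrite !(big_ord_widen _ _ MM) big_distrlr/= big_mkcond/=.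
apply: eq_bigr => k _; rewrite big_mkcond/=; case: ifP => // _.
by rewrite big1.
Qed.

(** Inside the small square the terms cancel; outside it each term is bounded by its modulus, and
    these moduli add up to the gap between the two squares. *)
Lemma sum_region_close (R : realType) (M M' : nat) (P : nat -> nat -> bool)
    (A B : nat -> R[i]) : (M <= M')%N ->
  (forall k l, (k < M)%N -> (l < M)%N -> P k l) ->
  Normc.normc ((\sum_(k < M') \sum_(l < M') if P k l then A k * B l else 0)
     - (\sum_(k < M) A k) * (\sum_(l < M) B l))
  <= (\sum_(k < M') Normc.normc (A k)) * (\sum_(l < M') Normc.normc (B l))
     - (\sum_(k < M) Normc.normc (A k)) * (\sum_(l < M) Normc.normc (B l)).
Proof.
move=> MM HP.
pose a k : R := Normc.normc (A k); pose b k : R := Normc.normc (B k).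
rewrite (prod_sum_box _ _ _ _ _ MM).
have -> : (\sum_(k < M) Normc.normc (A k)) * (\sum_(l < M) Normc.normc (B l)) =
    \sum_(k < M') \sum_(l < M') if (k < M)%N && (l < M)%N then a k * b l else 0.
  exact: prod_sum_box.
have -> : (\sum_(k < M') Normc.normc (A k)) * (\sum_(l < M') Normc.normc (B l)) =
    \sum_(k < M') \sum_(l < M') if (k < M')%N && (l < M')%N then a k * b l else 0.
  exact: prod_sum_box.
rewrite -!sumrB (le_trans (normc_sum _ _ _))//; apply: ler_sum => k _.
rewrite -!sumrB (le_trans (normc_sum _ _ _))//; apply: ler_sum => l _.
rewrite !ltn_ord/=; have [/andP[kM lM]|_] := boolP ((k < M)%N && (l < M)%N).
  by rewrite HP// !subrr Normc.normc0.
rewrite !subr0; case: ifP => _; first by rewrite Normc.normcM.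
by rewrite Normc.normc0 mulr_ge0 ?normc_ge0.
Qed.

Lemma cvg_normcM (R : realType) (u v : nat -> R[i]) (x y : R[i]) :
  (fun N => Normc.normc (u N - x)) @ \oo --> (0 : R) ->
  (fun N => Normc.normc (v N - y)) @ \oo --> (0 : R) ->
  (fun N => Normc.normc (u N * v N - x * y)) @ \oo --> (0 : R).
Proof.
move=> ux vy.
have : (fun N => Normc.normc (u N - x) * Normc.normc (v N - y) +
   (Normc.normc x * Normc.normc (v N - y) + Normc.normc (u N - x) * Normc.normc y))
   @ \oo --> (0 : R).
  have -> : (0 : R) = 0 * 0 + (Normc.normc x * 0 + 0 * Normc.normc y).
    by rewrite !mul0r mulr0 !addr0.
  apply: cvgD; first exact: cvgM.
  by apply: cvgD; apply: cvgM => //; exact: cvg_cst.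
apply: squeeze_cvgr (cvg_cst 0); near=> N; rewrite normc_ge0/= -!Normc.normcM.
(* Every summand contains a factor tending to 0. *)
have -> : u N * v N - x * y = (u N - x) * (v N - y) + (x * (v N - y) + (u N - x) * y).
  by ring.
by rewrite (le_trans (normcD _ _ _))// lerD2l normcD.
Unshelve. all: by end_near. Qed.

(** The sums of moduli over the inner and the outer squares have the same limit [a * b], so the part
    of the region outside the inner square is negligible. *)
Lemma cvg_sum_region (R : realType) (A B : nat -> R[i]) (P : nat -> nat -> nat -> bool)
    (M M' : nat -> nat) (x y : R[i]) (a b : R) :
  (forall N, M N <= M' N)%N ->
  (forall N k l, k < M N -> l < M N -> P N k l)%N ->
  M @ \oo --> \oo -> M' @ \oo --> \oo ->
  (fun N => \sum_(k < N) Normc.normc (A k)) @ \oo --> a ->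
  (fun N => \sum_(k < N) Normc.normc (B k)) @ \oo --> b ->
  (fun N => Normc.normc (\sum_(k < N) A k - x)) @ \oo --> (0 : R) ->
  (fun N => Normc.normc (\sum_(k < N) B k - y)) @ \oo --> (0 : R) ->
  (fun N => Normc.normc ((\sum_(k < M' N) \sum_(l < M' N)
     if P N k l then A k * B l else 0) - x * y)) @ \oo --> (0 : R).
Proof.
move=> MM HP Moo M'oo aa bb Ax By.
have h1 : (fun N => (\sum_(k < M' N) Normc.normc (A k)) * (\sum_(l < M' N) Normc.normc (B l))
   - (\sum_(k < M N) Normc.normc (A k)) * (\sum_(l < M N) Normc.normc (B l))) @ \oo --> (0 : R).
  rewrite -[X in _ --> X](subrr (a * b)); apply: cvgB; apply: cvgM.
  - exact: (@cvg_comp _ _ _ M' (fun n => \sum_(k < n) Normc.normc (A k) : R) _ _ _ M'oo aa).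
  - exact: (@cvg_comp _ _ _ M' (fun n => \sum_(k < n) Normc.normc (B k) : R) _ _ _ M'oo bb).
  - exact: (@cvg_comp _ _ _ M (fun n => \sum_(k < n) Normc.normc (A k) : R) _ _ _ Moo aa).
  - exact: (@cvg_comp _ _ _ M (fun n => \sum_(k < n) Normc.normc (B k) : R) _ _ _ Moo bb).
have h2 : (fun N => Normc.normc ((\sum_(k < M N) A k) * (\sum_(l < M N) B l) - x * y))
    @ \oo --> (0 : R).
  exact: (@cvg_comp _ _ _ M (fun n => Normc.normc (_ n * _ n - x * y) : R) _ _ _ Moo
    (cvg_normcM _ (fun n => \sum_(k < n) A k) (fun n => \sum_(l < n) B l) _ _ Ax By)).
have h3 := cvgD h1 h2; rewrite [X in _ --> X]addr0 in h3.
apply: (squeeze_cvgr _ (cvg_cst 0) (h3 _)).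
near=> N; rewrite normc_ge0/=.
set S := \sum_(k < M' N) \sum_(l < M' N) _.
rewrite fctE; pose T := (\sum_(k < M N) A k) * (\sum_(l < M N) B l).
have -> : S - x * y = (S - T) + (T - x * y) by rewrite addrA subrK.
rewrite (le_trans (normcD _ _ _))// lerD// sum_region_close//.
exact: HP.
Unshelve. all: by end_near. Qed.

(** The two filtered index lists are permutations of each other through [h]. Injectivity is asked on
    [Q] alone, since one of the maps used is a truncated subtraction. *)
Lemma sum_reindex_nat (V : nmodType) (N M : nat) (P Q : pred nat) (h : nat -> nat)
    (F : nat -> V) :
  {in Q &, injective h} ->
  (forall k, (k < M)%N -> Q k -> (h k < N)%N && P (h k)) ->
  (forall i, (i < N)%N -> P i -> exists2 k, (k < M)%N && Q k & i = h k) ->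
  \sum_(i < N | P i) F i = \sum_(k < M | Q k) F (h k).
Proof.
move=> hinj hQ hP.
rewrite -(big_mkord P F) -(big_mkord Q (fun k => F (h k))) -big_filter -[RHS]big_filter.
rewrite -(big_map h xpredT F); apply: perm_big; apply: uniq_perm.
- by rewrite filter_uniq// iota_uniq.
- rewrite map_inj_in_uniq ?filter_uniq ?iota_uniq// => u v.
  by rewrite !mem_filter => /andP[Qu _] /andP[Qv _]; exact: hinj.
- move=> i; rewrite mem_filter mem_index_iota/=; apply/idP/idP.
    move=> /andP[Pi iN]; have [k /andP[kM Qk] ->] := hP _ iN Pi.
    by apply: map_f; rewrite mem_filter Qk mem_index_iota.
  move=> /mapP[k]; rewrite mem_filter mem_index_iota/= => /andP[Qk kM] ->.
  by rewrite andbC hQ.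
Qed.

(** * The sub-Bergman kernel *)

(** [E_j] is the largest [e] with [m e < n (j + 1)]. *)
Lemma A2_shift (m n j N k i : nat) : (0 < m)%N -> (0 < n)%N ->
  A2 m n ((j + m * k)%N%:Z, i%:Z - N%:Z) =
  (N <= i + n * k + ((j + 1) * n - 1) %/ m + 1)%N.
Proof.
move=> m0 n0; rewrite /A2/=.
have := leq_trunc_div ((j + 1) * n - 1) m.
have := @ltn_ceil ((j + 1) * n - 1) m m0.
set E := (_ %/ m)%N => h1 h2.
have h3 : (0 < (j + 1) * n)%N by rewrite muln_gt0 addn1.
(* By the division bounds [n (j + 1) - m E] lies in [[1, m]]. Writing [alpha_2 = l - n k - E - 1],
   membership says [n (j + 1) - m E + m l >= 1], that is [l >= 0]. *)
case: leqP => h.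
  have [d hd] : exists d, (i + n * k + E + 1 = N + d)%N by exists (i + n * k + E + 1 - N)%N; lia.
  have -> : i%:Z - N%:Z = d%:Z - n%:Z * k%:Z - E%:Z - 1 by lia.
  apply/idP; nia.
have [d hd] : exists d, (i + n * k + E + 1 + d + 1 = N)%N.
  by exists (N - (i + n * k + E + 1) - 1)%N; lia.
have -> : i%:Z - N%:Z = - (d%:Z + n%:Z * k%:Z + E%:Z + 2) by lia.
by apply/negbTE; rewrite -ltNge; nia.
Qed.

(** Membership in [A2] makes the norm finite, so [fine] returns its actual value, whose inverse
    supplies the polynomial weight; conjugation passes through the powers. *)
Lemma KtermE (R : realType) (m n i : nat) (l : int) (z1 z2 w1 w2 : R[i]) :
  (0 < m)%N -> (0 < n)%N -> A2 m n (i%:Z, l) ->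
  Kterm m n (i%:Z, l) z1 z2 w1 w2 =
  (z1 * w1^*%C) ^+ i * (z2 * w2^*%C) ^ l *
  (i.+1%:R * (n%:R * i.+1%:R + m%:R * (l%:~R + 1))) / ((pi : R)%:C%C ^+ 2 * m%:R).
Proof.
move=> m0 n0 /andP[_ /= h].
rewrite /Kterm (monom_norm2E _ _ _ _ _ m0 n0 h) [fine _]/fine.
have -> (a b c : R) (d : int) : ((pi ^+ 2 * a / (b * (c * b + a * (d%:~R + 1))))%:C)%C =
    (pi : R)%:C%C ^+ 2 * a%:C%C / (b%:C%C * (c%:C%C * b%:C%C + a%:C%C * (d%:~R + 1))) :> R[i].
  by rewrite rmorphM fmorphV !(rmorphM, rmorphD, rmorphXn, rmorph_int, rmorph1).
rewrite !rmorph_nat invfM invrK /monom/= exprMn expfzMl.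
have -> : (w1 ^ i * w2 ^ l)^* = w1^*%C ^+ i * w2^*%C ^ l :> R[i].
  by rewrite rmorphM/= exprnP !fmorphXz.
rewrite -!exprnP -[RHS]mulrA [X in X * _ = _]mulrACA; congr (_ * _).
by rewrite mulrC.
Qed.

(** The bound makes the truncated subtraction exact. *)
Lemma subz_shift (a l N : nat) : (a <= l + N)%N ->
  l%:Z - a%:Z = (l + N - a)%N%:Z - N%:Z.
Proof. by lia. Qed.

(** Says [- N <= alpha_2 < N] for [alpha_2 = l - n k - E - 1]. *)
Definition box_cond (n E N k l : nat) : bool :=
  (n * k + E + 1 <= l + N)%N && (l + N < n * k + E + 1 + 2 * N)%N.

(** The divisor dominates every coefficient involved: [k + 1] times it is at most [N], which bounds
    both [j + m k] and [n k + E + 1], while [l < N] gives the upper bound. *)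
Lemma box_cond_small (m n E j N k l : nat) :
  (k < N %/ (m + n + E + j + 1))%N -> (l < N %/ (m + n + E + j + 1))%N ->
  (j + m * k < N)%N && box_cond n E N k l.
Proof.
set D := (m + n + E + j + 1)%N => kM lM.
have hk : (k.+1 * D <= N)%N.
  by rewrite (leq_trans _ (leq_trunc_div N D))// leq_mul2r kM orbT.
have hl : (l < N)%N by rewrite (leq_trans lM)// leq_div.
move: hk; rewrite /D /box_cond mulSn !mulnDr (mulnC k m) (mulnC k n).
move: (m * k)%N (n * k)%N (k * E)%N (k * j)%N => a b u v hk.
by apply/andP; split; [lia | apply/andP; split; lia].
Qed.

(** The bound [M'] is large enough for both new indices: [k < N], and [l = alpha_2 + n k + E + 1]
    with [alpha_2 < N]. *)
Lemma Kj_partial_reindex (R : realType) (m n j N : nat) (z1 z2 w1 w2 : R[i]) :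
  (0 < m)%N -> (0 < n)%N -> (j < m)%N ->
  let E := (((j + 1) * n - 1) %/ m)%N in
  let M' := (N + n * N + E + 1)%N in
  Kj_partial m n j z1 z2 w1 w2 N =
  \sum_(k < M') \sum_(l < M') if (j + m * k < N)%N && box_cond n E N k l then
     Kterm m n ((j + m * k)%N%:Z, l%:Z - (n * k + E + 1)%N%:Z) z1 z2 w1 w2 else 0.
Proof.
move=> m0 n0 jm E M'.
have aux a b e i : (a <= b -> N <= i + a + e + 1 -> i < 2 * N ->
    (i + a + e + 1 - N < N + b + e + 1) && ((a + e + 1 <= i + a + e + 1 - N + N) &&
    (i + a + e + 1 - N + N < a + e + 1 + 2 * N)))%N.
  by move=> ab Ni iN; apply/andP; split; [lia | apply/andP; split; lia].
pose H i := \sum_(k < 2 * N | A2 m n (i%:Z, k%:Z - N%:Z))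
  Kterm m n (i%:Z, k%:Z - N%:Z) z1 z2 w1 w2.
have HE k : H (j + m * k)%N = \sum_(i < 2 * N | (N <= i + n * k + E + 1)%N)
    Kterm m n ((j + m * k)%N%:Z, i%:Z - N%:Z) z1 z2 w1 w2.
  by apply: eq_bigl => i; exact: A2_shift.
(* The congruence concerns the first index only and moves to the outer sum; membership in [A2] stays
   in the inner sum [H]. *)
transitivity (\sum_(i < N | (i %% m == j)%N) H i).
  rewrite /Kj_partial [RHS]big_mkcond; apply: eq_bigr => i _.
  have mE : ((i%:Z == j%:Z %[mod m%:Z])%Z) = (i %% m == j)%N.
    by rewrite !modz_nat eqz_nat [X in _ == X]modn_small.
  case: ifP => ij.
    by rewrite /H [RHS]big_mkcond; apply: eq_bigr => k _; rewrite /Gj mE ij andbT.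
  by apply: big1 => k _; rewrite /Gj/= mE ij andbF.
rewrite (@sum_reindex_nat _ N M' (fun i => i %% m == j)%N (fun k => j + m * k < N)%N
  (fun k => j + m * k)%N H).
- rewrite big_mkcond; apply: eq_bigr => k _; case: ifP => /= kN; last by rewrite big1.
  rewrite HE.
  (* For fixed [k] the inner index [alpha_2 + N] is replaced by [l]. *)
  rewrite (@sum_reindex_nat _ (2 * N) M' (fun i => N <= i + n * k + E + 1)%N
    (box_cond n E N k) (fun l => l + N - (n * k + E + 1))%N
    (fun i => Kterm m n ((j + m * k)%N%:Z, i%:Z - N%:Z) z1 z2 w1 w2)).
  + rewrite big_mkcond; apply: eq_bigr => l _; rewrite /box_cond; case: ifP => // /andP[h1 h2].
    by rewrite (subz_shift _ _ _ h1).
  + move=> u v; rewrite /box_cond /in_mem/= => /andP[h1 h2] /andP[h3 h4]; lia.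
  + move=> l lM; rewrite /box_cond => /andP[h1 h2]; lia.
  + move=> i iN Ni; exists (i + n * k + E + 1 - N)%N; last by lia.
    rewrite /box_cond /M'.
    apply: aux => //; rewrite leq_mul2l (leq_trans (leq_pmull k m0)) ?orbT//.
    by rewrite ltnW// (leq_ltn_trans (leq_addl j _) kN).
- by move=> u v _ _ /addnI/eqP; rewrite eqn_pmul2l// => /eqP.
- by move=> k kM kN; rewrite kN/= addnC mulnC modnMDl modn_small.
- move=> i iN /eqP im; exists (i %/ m)%N; last by rewrite {1}(divn_eq i m) im addnC mulnC.
  rewrite -{1}im mulnC addnC -divn_eq iN andbT /M'.
  by rewrite (leq_ltn_trans (leq_div _ _))//; lia.
Qed.

(** * Factorisation of the terms, closed form and convergence *)

Lemma Hmn_bounds (R : realType) (m n : nat) (z : (R * R) * (R * R)) :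
  (0 < m)%N -> (0 < n)%N -> Hmn m n z ->
  [/\ 0 < cabs z.2, cabs z.2 < 1 & cabs z.1 ^+ m < cabs z.2 ^+ n].
Proof.
move=> m0 n0; rewrite /Hmn /mkset => /andP[h1 h2].
have b0 : 0 < cabs z.2 by rewrite (le_lt_trans _ h1)// powR_ge0.
split => //.
(* The [n]-th power turns the real exponent [m / n] into integer ones. *)
rewrite -(@ltr_powR2 _ n%:R) ?ltr0n ?powR_ge0 ?ltW// in h1.
rewrite -powRrM divfK ?pnatr_eq0 -?lt0n// in h1.
by rewrite -!powR_mulrn ?cabs_ge0.
Qed.

Lemma normc_conj (R : realType) (x : R[i]) : Normc.normc (x^*)%C = Normc.normc x.
Proof. by case: x => a b /=; rewrite sqrrN. Qed.

(** Since [1 - x = (t^n - s^m) / t^n], the first quotient is [f_j t^n / (t^n - s^m)^2], and the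
    extra [t^n] completes the exponent [n - 1 - E]. The numerator of the second is [n g_j], as
    [c = n (j + 1 - (m / n) E)]. *)
Lemma kernel_closed_form (K : fieldType) (s t p : K) (m n j E : nat) :
  (j < m)%N -> (m * E <= n * (j + 1))%N ->
  m%:R != 0 :> K -> n%:R != 0 :> K -> p != 0 -> t != 0 -> 1 - t != 0 ->
  t ^+ n - s ^+ m != 0 ->
  let x := s ^+ m / t ^+ n in
  let c := (n * (j + 1) - m * E)%N in
  s ^+ j / t ^+ (E + 1) / (p ^+ 2 * m%:R) *
  (((j + 1)%:R + (m%:R - (j + 1)%:R) * x) / (1 - x) ^+ 2 *
   ((c%:R + (m%:R - c%:R) * t) / (1 - t) ^+ 2)) =
  n%:R / (m%:R * p ^+ 2) *
      (((j + 1)%:R * t ^+ n + (m - j - 1)%:R * s ^+ m) *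
       (((j + 1)%:R - m%:R / n%:R * E%:R) +
        (m%:R / n%:R + m%:R / n%:R * E%:R - (j + 1)%:R) * t) * s ^+ j *
       t ^ (n%:Z - 1 - E%:Z)) /
      ((1 - t) ^+ 2 * (t ^+ n - s ^+ m) ^+ 2).
Proof.
move=> jm mE mN0 nN0 p0 t0 t1 ts x c.
have T0 : t ^+ n != 0 by rewrite expf_neq0.
have U0 : t ^+ (E + 1) != 0 by rewrite expf_neq0.
have -> : t ^ (n%:Z - 1 - E%:Z) = t ^+ n / t ^+ (E + 1).
  have -> : n%:Z - 1 - E%:Z = n%:Z - (E + 1)%N%:Z by lia.
  by rewrite expfzDr// -exprnN.
have -> : (m - j - 1)%:R = m%:R - (j + 1)%:R :> K.
  by rewrite -subnDA natrB // addn1.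
rewrite /c natrB// !natrM.
have x1 : 1 - x != 0.
  by rewrite /x -[1](divff T0) -mulrBl mulf_neq0 ?invr_eq0.
move: x1; rewrite /x.
move: (t ^+ n) (t ^+ (E + 1)) (s ^+ m) (s ^+ j) T0 U0 ts => T U S sj T0 U0 ts x1.
move: (m%:R) (n%:R) ((j + 1)%:R) (E%:R) mN0 nN0 => M N J e mN0 nN0.
by field; rewrite ts t1 U0 nN0 p0 mN0 T0.
Qed.

(** With [alpha_2 + 1 = l - n k - E] the products [m n k] cancel in the weight, leaving
    [n (j + 1) - m E + m l], which is free of [k]; the variables therefore separate. *)
Lemma term_factor (K : fieldType) (s t p : K) (m n j E k l : nat) :
  t != 0 -> (m * E <= n * (j + 1))%N ->
  s ^+ (j + m * k) * t ^ (l%:Z - (n * k + E + 1)%N%:Z) *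
  ((j + m * k).+1%:R * (n%:R * (j + m * k).+1%:R +
     m%:R * ((l%:Z - (n * k + E + 1)%N%:Z)%:~R + 1))) / (p ^+ 2 * m%:R) =
  s ^+ j / t ^+ (E + 1) / (p ^+ 2 * m%:R) *
  ((((j + 1)%:R + m%:R * k%:R) * (s ^+ m / t ^+ n) ^+ k) *
   (((n * (j + 1) - m * E)%:R + m%:R * l%:R) * t ^+ l)).
Proof.
move=> t0 mE.
have T0 : t ^+ (n * k) != 0 by rewrite expf_neq0.
have U0 : t ^+ (E + 1) != 0 by rewrite expf_neq0.
have -> : (j + m * k).+1%:R = (j + 1)%:R + m%:R * k%:R :> K.
  by rewrite -addn1 !natrD natrM; ring.
have -> : (l%:Z - (n * k + E + 1)%N%:Z)%:~R = l%:R - (n%:R * k%:R + E%:R + 1) :> K.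
  by rewrite rmorphB/= -!pmulrn !natrD natrM.
rewrite expfzDr// -exprnN -addnA !exprD exprM expr_div_n -!exprM natrB// !natrM.
rewrite invfM -exprnP; rewrite exprD in U0.
move: (t ^+ (n * k)) T0 (t ^+ E * t ^+ 1) U0 => T T0 U U0; move: (p ^+ 2 * _)^-1 => P.
by field; rewrite U0 T0.
Qed.

Theorem theorem2p4 (R : realType) (m n : nat) (hm : (0 < m)%N) (hn : (0 < n)%N)
  (hmn : coprime m n) (j : nat) (hj : (j < m)%N)
  (z w : (R * R) * (R * R)) (hz : Hmn m n z) (hw : Hmn m n w) :
  let s : R[i] := cplx z.1 * (cplx w.1)^*%C in
  let t : R[i] := cplx z.2 * (cplx w.2)^*%C in
  let E : nat := (((j + 1) * n - 1) %/ m)%N in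
  let mn : R[i] := m%:R / n%:R in
  let f : R[i] := (j + 1)%:R * t ^+ n + (m - j - 1)%:R * s ^+ m in
  let g : R[i] := ((j + 1)%:R - mn * E%:R) + (mn + mn * E%:R - (j + 1)%:R) * t in
  let K : R[i] := n%:R / (m%:R * (pi : R)%:C%C ^+ 2) *
      (f * g * s ^+ j * t ^ (n%:Z - 1 - E%:Z)) /
      ((1 - t) ^+ 2 * (t ^+ n - s ^+ m) ^+ 2) in
  (fun N => Normc.normc
     (Kj_partial m n j (cplx z.1) (cplx z.2) (cplx w.1) (cplx w.2) N - K))
    @ \oo --> (0 : R).
Proof.
move=> s t E mn f g K.
have [z0 z1 zz] := Hmn_bounds _ _ _ _ hm hn hz.
have [w0 w1 ww] := Hmn_bounds _ _ _ _ hm hn hw.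
have tE : Normc.normc t = cabs z.2 * cabs w.2 by rewrite Normc.normcM normc_conj.
have sE : Normc.normc s = cabs z.1 * cabs w.1 by rewrite Normc.normcM normc_conj.
have tgt0 : 0 < Normc.normc t by rewrite tE mulr_gt0.
have tlt1 : Normc.normc t < 1 by rewrite tE mulr_ilt1// ltW.
(* The product of the inequalities for [z] and [w]; it gives both [|x| < 1] and a nonzero
   denominator. *)
have st : Normc.normc s ^+ m < Normc.normc t ^+ n.
  by rewrite sE tE !exprMn ltr_pM// exprn_ge0// cabs_ge0.
have t0 : t != 0 by apply: contraTneq tgt0 => ->; rewrite Normc.normc0 ltxx.
have t1 : 1 - t != 0.
  by rewrite subr_eq0; apply: contraTneq tlt1 => <-; rewrite Normc.normc1 ltxx.
have ts : t ^+ n - s ^+ m != 0.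
  by rewrite subr_eq0; apply: contraTneq st; rewrite -!normcX => ->; rewrite ltxx.
pose x := s ^+ m / t ^+ n.
have x1 : Normc.normc x < 1.
  by rewrite Normc.normcM Normc.normcV !normcX ltr_pdivrMr ?mul1r// exprn_gt0.
(* This makes the natural subtraction in [c] exact. *)
have mE : (m * E <= n * (j + 1))%N.
  by rewrite mulnC (leq_trans (leq_trunc_div _ _))// mulnC leq_subr.
pose c := (n * (j + 1) - m * E)%N.
pose A k : R[i] := ((j + 1)%:R + m%:R * k%:R) * x ^+ k.
pose B l : R[i] := (c%:R + m%:R * l%:R) * t ^+ l.
have normAG (a b : nat) (y : R[i]) k :
    Normc.normc ((a%:R + b%:R * k%:R) * y ^+ k) = (a%:R + b%:R * k%:R) * Normc.normc y ^+ k.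
  by rewrite Normc.normcM normcX -natrM -natrD normc_nat natrD natrM.
have cvgnorm (a b : nat) (y : R[i]) : Normc.normc y < 1 ->
    (fun N => \sum_(k < N) Normc.normc ((a%:R + b%:R * k%:R) * y ^+ k)) @ \oo -->
    (a%:R + (b%:R - a%:R) * Normc.normc y) / (1 - Normc.normc y) ^+ 2.
  move=> y1; under eq_fun do under eq_bigr do rewrite normAG.
  by apply: cvg_arith_geom; rewrite normc_ge0.
pose C := s ^+ j / t ^+ (E + 1) / ((pi : R)%:C%C ^+ 2 * m%:R).
pose P N k l := (j + m * k < N)%N && box_cond n E N k l.
pose M' N := (N + n * N + E + 1)%N.
pose D := (m + n + E + j + 1)%N.
have D0 : (0 < D)%N by rewrite /D addn1.
pose M N := (N %/ D)%N.
have KE N : Kj_partial m n j (cplx z.1) (cplx z.2) (cplx w.1) (cplx w.2) N =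
    C * (\sum_(k < M' N) \sum_(l < M' N) if P N k l then A k * B l else 0).
  rewrite Kj_partial_reindex// mulr_sumr; apply: eq_bigr => k _.
  rewrite mulr_sumr; apply: eq_bigr => l _; rewrite -/E /P.
  case: ifPn => [/andP[_ /andP[h _]]|_]; last by rewrite mulr0.
  (* Each pair of naturals gives an exponent in [A2]: after the shift the condition reads
     [N <= l + N]. *)
  rewrite KtermE//; last first.
    rewrite (subz_shift _ _ _ h) A2_shift// -/E -addnA -addnA [(n * k + (E + 1))%N]addnA.
    by rewrite (subnK h) leq_addl.
  exact: term_factor.
have piN0 : (pi : R)%:C%C != 0 :> R[i].
  by rewrite fmorph_eq0 gt_eqF// pi_gt0.
have KK : K = C * (((j + 1)%:R + (m%:R - (j + 1)%:R) * x) / (1 - x) ^+ 2 *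
   ((c%:R + (m%:R - c%:R) * t) / (1 - t) ^+ 2)).
  by rewrite /K /f /g /mn kernel_closed_form ?pnatr_eq0 -?lt0n.
have Moo : M @ \oo --> \oo.
  apply/cvgnyPge => X; exists (X * D)%N => // N /= XN.
  by rewrite leq_divRL.
have M'oo : M' @ \oo --> \oo.
  by apply/cvgnyPge => X; exists X => // N /= XN;
    rewrite /M' -!addnA (leq_trans XN)// leq_addr.
have MM N : (M N <= M' N)%N.
  by rewrite (leq_trans (leq_div _ _))// /M' -!addnA leq_addr.
have MP N k l : (k < M N)%N -> (l < M N)%N -> P N k l by exact: box_cond_small.
have h := cvg_sum_region _ A B P M M' _ _ _ _ MM MP Moo M'oo
  (cvgnorm (j + 1)%N m x x1) (cvgnorm c m t tlt1)
  (cvg_arith_geomC _ _ _ _ x1) (cvg_arith_geomC _ _ _ _ tlt1).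
(* The common prefactor [C] comes out of the difference as a constant modulus. *)
under eq_fun do rewrite KE KK -mulrBr Normc.normcM.
have h' : (fun N : nat => Normc.normc C) @ \oo --> (Normc.normc C : R) by exact: cvg_cst.
by have := cvgM h' h; rewrite mulr0; exact.
Qed.
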